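(* Let $s\ge 2$ be an integer, and let $X$ and $Y$ be two connected graphs of order $n\ge 6$ with $\delta(Y)\ge\delta(X)$, $\Delta(X)\ge\frac{4}{3}\delta(X)$ and $2\delta(X)+3\delta(Y)\ge 3n+\frac{3s}{2}-3$. Then $\mathrm{FS}(X,Y)$ is $s$-connected.
   Context: All graphs are finite and simple; the order of a graph is its number of vertices. For two graphs $X,Y$ of the same order $n$, the friends-and-strangers graph $\mathrm{FS}(X,Y)$ has as vertices all bijections $\sigma:V(X)\to V(Y)$; two bijections $\sigma,\sigma'$ are adjacent if and only if there are distinct $a,b\in V(X)$ with $ab\in E(X)$, $\sigma(a)\sigma(b)\in E(Y)$, $\sigma(a)=\sigma'(b)$, $\sigma(b)=\sigma'(a)$, and $\sigma(c)=\sigma'(c)$ for all $c\in V(X)\setminus\{a,b\}$. $\delta(G)$ and $\Delta(G)$ are the minimum and maximum degree of $G$. A graph $G$ is $s$-connected if it has more than $s$ vertices and removing any $s-1$ vertices leaves a connected graph. *)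

(* Defs.v *)
From HB Require Import structures.
From mathcomp Require Import all_boot all_order all_algebra.

Set Implicit Arguments.
Unset Strict Implicit.
Unset Printing Implicit Defensive.

Record sgraph := SGraph {
  vertex :> finType;
  adj : rel vertex;
  adj_sym : symmetric adj;
  adj_irrefl : irreflexive adj }.

Arguments adj {s} : rename.

Section GraphInvariants.
Variable G : sgraph.

Definition degree (x : G) : nat := #|[set y | adj x y]|.

(* Degrees are at most the order, so the default value #|G| of the minimum is
   harmless as soon as G has a vertex. *)
Definition min_degree : nat := \big[minn/#|G|]_(x : G) degree x.

Definition max_degree : nat := \max_(x : G) degree x.

Definition connected : Prop := 0 < #|G| /\ forall x y : G, connect adj x y.

End GraphInvariants.

Section Deletion.
Variables (G : sgraph) (S : {set G}).

Definition del_vertex : finType := {x : G | x \notin S}.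

Definition del_adj : rel del_vertex := fun x y => adj (val x) (val y).

Lemma del_adj_sym : symmetric del_adj.
Proof. by move=> x y; rewrite /del_adj adj_sym. Qed.

Lemma del_adj_irrefl : irreflexive del_adj.
Proof. by move=> x; rewrite /del_adj adj_irrefl. Qed.

Definition del_vertices : sgraph := SGraph del_adj_sym del_adj_irrefl.

End Deletion.

(* Only meaningful for 0 < s. *)
Definition s_connected (s : nat) (G : sgraph) : Prop :=
  s < #|G| /\ forall S : {set G}, #|S| = s.-1 -> connected (del_vertices S).

Section FriendsAndStrangers.
Variables X Y : sgraph.

Definition bijectiveb (f : {ffun X -> Y}) : bool :=
  injectiveb f && [forall y, y \in codom f].

Lemma bijectivebP (f : {ffun X -> Y}) : reflect (bijective f) (bijectiveb f).
Proof.
apply: (iffP andP) => [[/injectiveP injf /forallP surjf] | bijf].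
  exists (fun y => iinv (surjf y)) => [x | y]; last exact: f_iinv.
  by apply: injf; rewrite f_iinv.
have [g fK gK] := bijf; split; first exact/injectiveP/bij_inj.
by apply/forallP => y; rewrite -[y]gK codom_f.
Qed.

Definition FS_vertex : finType := {f : {ffun X -> Y} | bijectiveb f}.

Definition FS_adj : rel FS_vertex := fun sigma tau =>
  let f := val sigma in let g := val tau in
  [exists a, exists b,
    [&& a != b, adj a b, adj (f a) (f b), f a == g b, f b == g a
      & [forall c, (c != a) && (c != b) ==> (f c == g c)]]].

Lemma FS_adj_sym : symmetric FS_adj.
Proof.
suff sub sigma tau : FS_adj sigma tau -> FS_adj tau sigma.
  by move=> sigma tau; apply/idP/idP; apply: sub.
case/existsP=> a /existsP[b /and5P[neq_ab ab fab /eqP fa /andP[/eqP fb /forallP fc]]].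
apply/existsP; exists a; apply/existsP; exists b.
rewrite neq_ab ab -fa -fb !eqxx adj_sym fab /=.
by apply/forallP => c; rewrite [X in _ ==> X]eq_sym; apply: fc.
Qed.

Lemma FS_adj_irrefl : irreflexive FS_adj.
Proof.
move=> sigma; apply/negbTE/negP.
case/existsP=> a /existsP[b /and5P[_ _ fab /eqP fa _]].
by rewrite fa adj_irrefl in fab.
Qed.

Definition FS : sgraph := SGraph FS_adj_sym FS_adj_irrefl.

End FriendsAndStrangers.

(* Main.v *)
Require Import Defs.
From mathcomp Require Import all_boot all_order all_algebra.
From mathcomp Require Import perm zify lra.

Set Implicit Arguments.
Unset Strict Implicit.
Unset Printing Implicit Defensive.

Import Num.Theory GRing.Theory.

(** Read a bijection sigma : X -> Y as people (vertices of Y) standing on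
    positions (vertices of X); two friends on adjacent positions may swap.
    Put k = n - 1 - delta(Y), so that everybody has at most k strangers.  The
    bound on 2 delta(X) + 3 delta(Y) says delta(X) >= 3k/2 + 3s/4, and then
    Delta(X) >= 4 delta(X)/3 gives a position v, the hub, with at least 2k + s
    neighbours, the leaves.  So any two people have at least s - 1 common
    friends among those standing on the hub and the leaves; the whole proof
    lives on this surplus and on the connectedness of X ([FS_s_connected]).

    Connectedness of FS(X, Y).  Call two positions exchangeable if, from every
    arrangement, the people on them can be made to trade places, everybody
    else returning to their position.  This is an equivalence relation on
    positions.  With 2k + 2 leaves every leaf is exchangeable with the hub
    ([exchangeable_hub]): non-friends trade places by means of common friends,
    as in Wilson's analysis of star graphs.  The class of the hub then spreads
    along every edge of X ([exchangeable_adj]), hence is everything, and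
    transpositions generate all rearrangements.

    From connected to s-connected.  It is enough that whenever |S| < s and
    z lies in S, any two neighbours of z outside S are linked outside S: then
    the vertices of S can be deleted one by one, bypassing each deleted vertex
    ([s_connected_of_local]).

    Neighbours of z.  If both come from swaps at the hub, with leaves a and b,
    each further leaf g holding a common friend of the people on a and b gives
    a detour around a cycle of length 12, and if these two people are friends
    there is one more, around a hexagon ([link_hub_swaps]).  A neighbour
    coming from a swap away from the hub is first linked to one coming from a
    swap at the hub, by a square or again by a hexagon ([link_to_hub_swap]).
    The detours are told apart by the leaf g they disturb, so a deleted
    vertex other than z obstructs at most one of them ([free_leaf]).  There
    are at least s - 1 detours against at most s - 2 obstructions. *)

(** * Connectivity from local detours *)

Section Cuts.
Variable G : sgraph.
Implicit Type S : {set G}.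

(** Deletion as a relation on G itself, so that different S share one type. *)
Definition avoid S : rel G :=
  [rel x y | [&& adj x y, x \notin S & y \notin S]].

Lemma avoid_connect_sym S : connect_sym (avoid S).
Proof.
apply: sym_connect_sym => x y; rewrite /avoid /= adj_sym.
by case: (adj y x) => //=; rewrite andbC.
Qed.

Definition locally_linked s := forall S (z x y : G), #|S| < s ->
  z \in S -> x \notin S -> y \notin S -> adj z x -> adj z y ->
  connect (avoid S) x y.

(** Walk from x to y outside S; each visit to z is cut short by linking the
    vertices before and after it.  The induction on the walk must therefore
    also cover walks starting at z, where every neighbour of z outside z |: S
    may serve as the start. *)
Lemma bypass S (z y : G) :
    (forall x1 x2, x1 \notin z |: S -> x2 \notin z |: S ->
      adj z x1 -> adj z x2 -> connect (avoid (z |: S)) x1 x2) ->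
    y \notin z |: S ->
  forall x, x \notin z |: S -> connect (avoid S) x y ->
  connect (avoid (z |: S)) x y.
Proof.
move=> link yS x xS /connectP[p xp def_y].
suff: (x != z -> connect (avoid (z |: S)) x y) /\
      (x = z -> forall w, w \notin z |: S -> adj z w ->
         connect (avoid (z |: S)) w y).
  by case=> + _; apply; apply: contraNneq xS => ->; rewrite setU11.
have outE u : u \notin S -> u != z -> u \notin z |: S.
  by move=> uS uz; rewrite !inE negb_or uz.
elim: p x xp def_y {xS} => [|x' p IHp] x /= => [_ yx | /andP[xx' pp] yl].
  split=> [_|xz]; first by rewrite yx.
  by rewrite yx xz setU11 in yS.
have [IH1 IH2] := IHp _ pp yl; case/and3P: xx' => xx' xS x'S.
have [x'z | x'z] := eqVneq x' z.
  split=> [xz | xz]; last by rewrite xz x'z adj_irrefl in xx'.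
  by apply: IH2; rewrite ?outE // adj_sym -x'z.
split=> [xz | xz w wS zw].
  apply: connect_trans (IH1 x'z); apply: connect1.
  by rewrite /avoid /= xx' !outE.
apply: connect_trans (IH1 x'z).
by apply: link => //; [exact: outE | rewrite -xz].
Qed.

(** Among the sets that disconnect G, a smallest one has each of its vertices
    adjacent to two different components of the rest; the induction on |S|
    below is this remark in positive form. *)
Lemma s_connected_of_local s : 0 < s -> s < #|G| -> connected G ->
  locally_linked s -> s_connected s G.
Proof.
move=> s_gt0 ltsG [_ conG] link.
have linkS S x y :
    #|S| < s -> x \notin S -> y \notin S -> connect (avoid S) x y.
  elim: {S}_.+1 {-2}S (ltnSn #|S|) x y => // m IHm S ltSm x y ltSs xS yS.
  have [S0 | [z zS]] := set_0Vmem S.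
    rewrite (@eq_connect _ _ adj) // => a b.
    by rewrite /avoid S0 /= !inE !andbT.
  have DS : S = z |: (S :\ z) by rewrite setD1K.
  have ltS' : #|S :\ z| < #|S| by rewrite [X in _ < X](cardsD1 z) zS.
  rewrite DS; apply: bypass; rewrite -?DS //.
  - by move=> x1 x2 x1S x2S zx1 zx2; apply: link zx1 zx2.
  - apply: IHm; rewrite ?inE ?(negbTE xS) ?(negbTE yS) ?andbF //.
      exact: leq_trans ltS' _.
    exact: ltn_trans ltS' _.
split=> // S cardS.
have ltSs : #|S| < s by rewrite cardS prednK.
split.
  by rewrite card_sig -(ltn_add2l #|S|) addn0 cardC; apply: ltn_trans ltSs _.
move=> x y; have [x0 y0] := (valP x, valP y).
have /connectP[p xp def_y] := linkS S (val x) (val y) ltSs x0 y0.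
elim: p x x0 xp def_y => [|w p IHp] x xS /=.
  by move=> _ /val_inj ->; apply: connect0.
case/andP=> /and3P[xw _ wS] wp def_y.
by apply: connect_trans (IHp (Sub w wS) wS wp def_y); apply: connect1.
Qed.

End Cuts.

(** * Trading two positions *)

Lemma tperm_ifE (T : finType) (i j c : T) :
  tperm i j c = if c == i then j else if c == j then i else c.
Proof.
case: eqVneq => [->|ci]; first by rewrite tpermL.
case: eqVneq => [->|cj]; first by rewrite tpermR.
by rewrite tpermD // eq_sym.
Qed.

Section Swap.
Variables X Y : sgraph.
Implicit Types z w : FS X Y.

Lemma swap_subproof z (i j : X) :
  bijectiveb [ffun c => val z (tperm i j c)].
Proof.
apply/bijectivebP.
have /bijectivebP bz := valP z.
apply: (eq_bij (bij_comp bz (inv_bij (@tpermK _ i j)))) => c.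
by rewrite ffunE.
Qed.

Definition swap z (i j : X) : FS X Y :=
  exist (fun f => is_true (bijectiveb f)) _ (swap_subproof z i j).

Lemma swapE z i j c : val (swap z i j) c = val z (tperm i j c).
Proof. by rewrite /= ffunE. Qed.

Lemma swapL z i j : val (swap z i j) i = val z j.
Proof. by rewrite swapE tpermL. Qed.

Lemma swapR z i j : val (swap z i j) j = val z i.
Proof. by rewrite swapE tpermR. Qed.

Lemma swapD z i j c : i != c -> j != c -> val (swap z i j) c = val z c.
Proof. by move=> ic jc; rewrite swapE tpermD. Qed.

Lemma FS_ext z w : val z =1 val w -> z = w.
Proof. by move=> zw; apply/val_inj/ffunP. Qed.

Lemma FS_inj z : injective (val z).
Proof. by have /bijectivebP/bij_inj := valP z. Qed.

End Swap.

(** Equalities and friendships between people after a few swaps, by cases on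
    which positions coincide.  Innermost tests go first, so that every
    remaining test compares variables. *)
Ltac swap_cases :=
  rewrite ?inE ?swapE ?tperm_ifE;
  repeat match goal with H : is_true (_ != _) |- _ => move: H => /eqP H end;
  repeat match goal with |- context [?x == ?y] =>
    lazymatch x with context [_ == _] => fail | _ => idtac end;
    lazymatch y with context [_ == _] => fail | _ => idtac end;
    case: (@eqP _ x y) => ?; try congruence
  end; try congruence; try done; try by rewrite adj_sym.

Section Swaps.
Variables X Y : sgraph.
Implicit Types z w : FS X Y.

Lemma swapC z i j : swap z i j = swap z j i.
Proof. by apply: FS_ext => c; rewrite !swapE tpermC. Qed.

Lemma swapii z i : swap z i i = z.
Proof. by apply: FS_ext => c; rewrite swapE tperm1 perm1. Qed.

Lemma swap_conj z i j l : i != j -> i != l -> j != l ->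
  swap (swap (swap z i j) j l) i j = swap z i l.
Proof.
by move=> ij il jl; apply: FS_ext => c; swap_cases.
Qed.

Lemma swap_comm z i j a b : i != a -> i != b -> j != a -> j != b ->
  swap (swap z i j) a b = swap (swap z a b) i j.
Proof.
by move=> ia ib ja jb; apply: FS_ext => c; swap_cases.
Qed.

Lemma FS_adj_swap z i j : adj i j -> adj (val z i) (val z j) ->
  adj z (swap z i j).
Proof.
move=> ij zij; apply/existsP; exists i; apply/existsP; exists j.
rewrite ij zij swapL swapR !eqxx /=.
have -> /= : i != j by apply: contraTneq ij => ->; rewrite adj_irrefl.
by apply/forallP => c; apply/implyP => /andP[ci cj]; rewrite swapD // eq_sym.
Qed.

Lemma FS_adjP z w : adj z w ->
  exists i j, [/\ adj i j, adj (val z i) (val z j) & w = swap z i j].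
Proof.
case/existsP=> i /existsP[j].
case/and5P=> _ ij zij /eqP zi /andP[/eqP zj /forallP zc].
exists i, j; split=> //; apply: FS_ext => c; rewrite swapE.
case: tpermP => [-> | -> | /eqP ci /eqP cj] //.
by have /implyP/(_ _)/eqP <- := zc c; rewrite ?ci.
Qed.

End Swaps.

(** * Few strangers make the graph connected *)

Section Mixing.
Variables (X Y : sgraph) (k : nat).
Hypothesis few_strangers :
  forall y : Y, #|[set y' | (y' != y) && ~~ adj y y']| <= k.
Implicit Types (z w : FS X Y) (A B C : {set X}).

Definition strangers z (c : X) : {set X} :=
  [set e | (e != c) && ~~ adj (val z c) (val z e)].

Definition friends z (c : X) : {set X} := [set e | adj (val z c) (val z e)].

Lemma friends_sym z c d : (c \in friends z d) = (d \in friends z c).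
Proof. by rewrite !inE adj_sym. Qed.

Lemma strangers_sym z c d : (c \in strangers z d) = (d \in strangers z c).
Proof. by rewrite !inE adj_sym eq_sym. Qed.

Lemma friendsD1 z c : c \notin friends z c.
Proof. by rewrite inE adj_irrefl. Qed.

Lemma friends_neq z c d : d \in friends z c -> c != d.
Proof. by apply: contraTneq => ->; apply: friendsD1. Qed.

Lemma strangersE z c d :
  d != c -> (d \in strangers z c) = (d \notin friends z c).
Proof. by move=> dc; rewrite !inE dc. Qed.

Lemma card_strangers z c : #|strangers z c| <= k.
Proof.
apply: leq_trans (few_strangers (val z c)).
rewrite -(card_imset _ (@FS_inj _ _ z)); apply: subset_leq_card.
apply/subsetP=> _ /imsetP[e + ->]; rewrite !inE => /andP[ec ->].
by rewrite (inj_eq (@FS_inj _ _ z)) ec.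
Qed.

(** Here B collects strangers already known to lie outside A; each of them
    improves the count by one, which the tight counts at the hub rely on. *)
Lemma card_friends z c A B :
    c \notin A -> B \subset strangers z c -> [disjoint A & B] ->
  #|A| + #|B| <= k + #|A :&: friends z c|.
Proof.
move=> cA BS AB; rewrite -(cardsID (friends z c) A) -addnA addnC leq_add2r.
apply: leq_trans (card_strangers z c).
have /eqP <- : #|A :\: friends z c :|: B| == #|A :\: friends z c| + #|B|.
  rewrite (leq_card_setU _ _).2.
  exact: disjointWl (subsetDl _ _) AB.
apply: subset_leq_card; rewrite subUset BS andbT.
apply/subsetP=> e; rewrite in_setD => /andP[ef eA].
by rewrite strangersE //; apply: contraNneq cA => <-.
Qed.

Lemma card_common_friends z c d A B C :
    c \notin A -> d \notin A ->
    B \subset strangers z c -> C \subset strangers z d ->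
    [disjoint A & B] -> [disjoint A & C] ->
  #|A| + #|B| + #|C| <= k.*2 + #|A :&: friends z c :&: friends z d|.
Proof.
move=> cA dA Bc Cd AB AC.
have leB := card_friends cA Bc AB.
have dA' : d \notin A :&: friends z c by rewrite inE (negPf dA).
have leC := card_friends dA' Cd (disjointWl (subsetIl _ _) AC).
lia.
Qed.

Notation joined := (connect (@adj (FS X Y))).

Lemma joined_sym : connect_sym (@adj (FS X Y)).
Proof. exact/sym_connect_sym/adj_sym. Qed.

Lemma joined_swap z i j : adj i j -> j \in friends z i -> joined z (swap z i j).
Proof. by rewrite inE => ij zij; apply/connect1/FS_adj_swap. Qed.

(** The people on i and j need not be friends and i, j need not be adjacent;
    all arrangements are quantified over so that the relation is transitive
    by conjugation. *)
Definition exchangeable (i j : X) := forall z, joined z (swap z i j).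

Lemma exchangeable_sym i j : exchangeable i j -> exchangeable j i.
Proof. by move=> ij z; rewrite swapC. Qed.

Lemma exchangeable_trans j i l :
  exchangeable i j -> exchangeable j l -> exchangeable i l.
Proof.
move=> ij jl z.
have [->|ni] := eqVneq i j; first exact: jl.
have [<-|nl] := eqVneq j l; first exact: ij.
have [->|nil] := eqVneq i l; first by rewrite swapii.
rewrite -(@swap_conj _ _ z i j l) //.
exact: connect_trans (ij z) (connect_trans (jl _) (ij _)).
Qed.

(** Every swap that sends home one more person of w brings z closer to w. *)
Lemma joined_of_exchangeable :
  (forall i j, exchangeable i j) -> forall z w : FS X Y, joined z w.
Proof.
move=> exch z w.
elim: {z}_.+1 {-2}z (ltnSn #|[set c | val z c != val w c]|) => // m IHm z.
rewrite ltnS => ltm; have [->|] := eqVneq z w; first exact: connect0.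
move=> zw; have [i zi] : exists i, val z i != val w i.
  apply/existsP; apply: contraNT zw; rewrite negb_exists => /forallP eqzw.
  by apply/eqP/FS_ext => c; apply/eqP; rewrite -[_ == _]negbK.
have /bijectivebP[g gK Kg] := valP z.
pose j := g (val w i); have zj : val z j = val w i by rewrite /j Kg.
have ij : i != j by apply: contra_neq zi => ij; rewrite [in LHS]ij.
apply: connect_trans (exch i j z) _; apply: IHm.
apply: leq_trans ltm; apply/proper_card/properP; split.
  apply/subsetP=> c; rewrite !inE.
  have [<-|ic] := eqVneq i c; first by rewrite swapL zj eqxx.
  have [<-|jc] := eqVneq j c; last by rewrite swapD.
  by rewrite zj (inj_eq (@FS_inj _ _ w)) => _; rewrite (negPf ij).
exists i; rewrite !inE //. by rewrite swapL zj eqxx.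
Qed.


Lemma common_friend z c d A B C :
    k.*2 < #|A| + #|B| + #|C| -> c \notin A -> d \notin A ->
    B \subset strangers z c -> C \subset strangers z d ->
    [disjoint A & B] -> [disjoint A & C] ->
  exists e, [/\ e \in A, e \in friends z c & e \in friends z d].
Proof.
move=> ltk cA dA Bc Cd AB AC.
have := card_common_friends cA dA Bc Cd AB AC => leq_k.
have /card_gt0P[e] : 0 < #|A :&: friends z c :&: friends z d| by lia.
by rewrite !in_setI => /andP[/andP[eA ec] ed]; exists e.
Qed.

Section Hub.
Variable v : X.
Let N : {set X} := [set u | adj v u].

Lemma hub_neq u : u \in N -> v != u.
Proof. by rewrite inE; apply: contraTneq => <-; rewrite adj_irrefl. Qed.

(** The friend on h steps into the hub, and steps back once the exchange has
    been made: h differs from a and b, so the two steps cancel. *)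
Lemma joined_conj z h a b : h \in N -> h != a -> h != b -> a \in N -> b \in N ->
    h \in friends z v -> joined (swap z v h) (swap (swap z v h) a b) ->
  joined z (swap z a b).
Proof.
move=> hN ha hb aN bN zh sw; move: hN; rewrite inE => vh.
have [va vb] := (hub_neq aN, hub_neq bN).
apply: connect_trans (joined_swap vh zh) (connect_trans sw _).
rewrite swap_comm // joined_sym; apply: joined_swap => //.
by rewrite inE in zh; swap_cases.
Qed.

(** The transposition (a b) is (v a)(v b)(v a). *)
Lemma joined_triangle z a b : a \in N -> b \in N ->
    a \in friends z v -> b \in friends z v -> b \in friends z a ->
  joined z (swap z a b).
Proof.
move=> aN bN za zb zab.
have [[va vb] ab] := (hub_neq aN, hub_neq bN, friends_neq zab).
have av : a != v by rewrite eq_sym.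
have -> : swap z a b = swap (swap (swap z v a) v b) v a.
  by rewrite [swap z v a]swapC [RHS]swapC swap_conj.
rewrite !inE in aN bN za zb zab.
apply: connect_trans (joined_swap aN _) _; first by rewrite inE.
apply: connect_trans (joined_swap bN _) _.
  by swap_cases.
by apply: joined_swap; swap_cases.
Qed.

Lemma hub_friend_via z h a b : a \in N -> b \in N -> h \in N ->
    h != a -> h != b -> h \in friends z v ->
    h \in friends z a -> h \in friends z b -> b \in friends z a ->
  joined z (swap z a b).
Proof.
move=> aN bN hN ha hb zh ah bh ab.
have [[va vb] vh] := (hub_neq aN, hub_neq bN, hub_neq hN).
apply: (joined_conj hN) => //; rewrite !inE in zh ah bh ab.
by apply: joined_triangle => //; swap_cases.
Qed.

Hypothesis hub : k.*2 + 2 <= degree v.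

Lemma card_hub2 a b : a != b -> a \in N -> b \in N -> k.*2 <= #|N :\ a :\ b|.
Proof.
move=> ab aN bN; move: hub.
rewrite /degree -/N (cardsD1 a N) (cardsD1 b (N :\ a)).
by rewrite aN in_setD1 eq_sym ab bN; lia.
Qed.

(** If the hub is not a friend of both, a common friend of theirs must take its
    place.  Such a friend h exists because the hub is already one of the
    strangers of a or b; if h cannot enter the hub directly, a common friend h'
    of h and the hub steps in between. *)
Lemma joined_leaf_friends z a b : a \in N -> b \in N -> b \in friends z a ->
  joined z (swap z a b).
Proof.
move=> aN bN zab; have ab := friends_neq zab.
have [va vb] := (hub_neq aN, hub_neq bN).
have cardA := card_hub2 ab aN bN; set A := N :\ a :\ b in cardA.
have AP e : e \in A -> [/\ e \in N, e != a & e != b].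
  by rewrite !inE => /and3P[].
have aA : a \notin A by rewrite !inE eqxx andbF.
have bA : b \notin A by rewrite !inE eqxx.
have vA : v \notin A by rewrite !inE adj_irrefl !andbF.
have [/andP[av bv]|nfr] := boolP ((a \in friends z v) && (b \in friends z v)).
  exact: joined_triangle.
pose B := [set v] :&: strangers z a; pose C := [set v] :&: strangers z b.
have cardBC : 0 < #|B| + #|C|.
  rewrite addn_gt0 !card_gt0.
  move: nfr; rewrite negb_and => /orP[nf|nf]; apply/orP; [left | right];
    by apply/set0Pn; exists v; rewrite in_setI set11 strangersE // friends_sym.
have vD D : [disjoint A & [set v] :&: D].
  by apply: disjointWr (subsetIl _ _) _; rewrite disjoint_sym disjoints1.
have [|h [hA ha hb]] := @common_friend z a b A B C _ aA bA
  (subsetIr _ _) (subsetIr _ _) (vD _) (vD _).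
  by rewrite -addnA (leq_ltn_trans cardA) // -[X in X < _]addn0 ltn_add2l.
have [hN hna hnb] := AP h hA; have vh := hub_neq hN.
have [zvh | zvh] := boolP (h \in friends z v).
  exact: hub_friend_via hN _ _ _ _ _ _.
pose B' := ([set a; b; h] :&: strangers z v); pose C' := [set v].
have cardB' : 2 <= #|B'|.
  rewrite (cardsD1 h) in_setI strangersE 1?eq_sym // zvh !inE eqxx orbT /=.
  rewrite ltnS card_gt0; apply/set0Pn.
  move: nfr; rewrite negb_and => /orP[nf|nf]; [exists a | exists b];
  by rewrite in_setD1 [_ == h]eq_sym ?hna ?hnb in_setI strangersE
     1?eq_sym // nf !inE eqxx ?orbT.
have cardAh : #|A| = (#|A :\ h|).+1 by rewrite (cardsD1 h) hA.
(* Room for h': the hub has two known strangers, h and one of a, b; and h has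
   the hub as a known stranger. *)
have [|||||||h' [h'A h'v h'h]] := @common_friend z v h (A :\ h) B' C'.
- rewrite cards1 addn1 ltnS (leq_trans cardA) // cardAh -addn1 leq_add2l.
  exact: ltnW.
- by rewrite in_setD1 (negPf vA) andbF.
- by rewrite setD11.
- exact: subsetIr.
- by rewrite sub1set strangers_sym strangersE // eq_sym.
- apply: disjointWr (subsetIl _ _) _; rewrite disjoint_sym.
  rewrite disjoint_subset; apply/subsetP=> e; rewrite !inE.
  by case/orP=> [/orP[]|] /eqP->; rewrite !eqxx ?andbF.
- by rewrite disjoint_sym disjoints1 in_setD1 (negPf vA) andbF.
move: h'A; rewrite in_setD1 => /andP[h'nh /AP[h'N h'na h'nb]].
have vh' := hub_neq h'N.
apply: (joined_conj h'N) => //.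
rewrite !inE in ha hb h'h zab.
by apply: (hub_friend_via aN bN hN) => //; swap_cases.
Qed.

(** Strangers p on v and q on a: bring a common friend t from a leaf g into the
    hub, let q take the hub; p is now on g and t on a, and these two are friends
    on leaves. *)
Lemma exchangeable_hub a : a \in N -> exchangeable v a.
Proof.
move=> aN z; have va := hub_neq aN.
have [zva | zva] := boolP (a \in friends z v).
  by apply: joined_swap; rewrite // inE in aN.
have [|||||||g [gA gv ga]] := @common_friend z v a (N :\ a) [set a] [set v].
- by move: hub; rewrite /degree -/N (cardsD1 a N) aN !cards1; lia.
- by rewrite !inE adj_irrefl andbF.
- by rewrite setD11.
- by rewrite sub1set strangersE // eq_sym.
- by rewrite sub1set strangers_sym strangersE // eq_sym.
- by rewrite disjoint_sym disjoints1 setD11.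
- by rewrite disjoint_sym disjoints1 !inE adj_irrefl andbF.
move: gA; rewrite in_setD1 => /andP[ga' gN]; have vg := hub_neq gN.
have -> : swap z v a = swap (swap (swap z v g) v a) a g.
  by apply: FS_ext => c; swap_cases.
rewrite !inE in gv ga.
have [adj_va adj_vg] : adj v a /\ adj v g by rewrite !inE in aN gN.
apply: connect_trans (joined_swap adj_vg _) _; first by rewrite inE.
apply: connect_trans (joined_swap adj_va _) (joined_leaf_friends aN gN _).
  by swap_cases.
by swap_cases.
Qed.

(** Let p on a and q on b be strangers.  Among the hub and its leaves, all
    exchangeable with b, some c holds a common friend t of theirs.  Use
    (b c), (b a), (b c), (b a), (b c): across the edge ba only t meets p, then
    q meets t. *)
Lemma exchangeable_adj a b :
  exchangeable v b -> adj b a -> exchangeable v a.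
Proof.
move=> vb adj_ba; have adj_ab : adj a b by rewrite adj_sym.
apply: (exchangeable_trans vb) => z.
have ab : a != b by apply: contraTneq adj_ab => ->; rewrite adj_irrefl.
have [zab | zab] := boolP (a \in friends z b); first exact: joined_swap.
pose M := (v |: N) :\ a :\ b.
have cardM : k.*2 < #|M| + #|[set a]| + #|[set b]|.
  rewrite !cards1; have : #|v |: N| <= #|M| + 2.
    rewrite (cardsD1 a) (cardsD1 b (_ :\ a)) -/M.
    by case: (a \in _); case: (b \in _); lia.
  by rewrite cardsU1 inE adj_irrefl; move: hub; rewrite /degree -/N; lia.
have [||||||c [cM cb ca]] := @common_friend z b a M [set a] [set b] cardM.
- by rewrite setD11.
- by rewrite in_setD1 setD11 andbF.
- by rewrite sub1set strangersE.
- by rewrite sub1set strangers_sym strangersE.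
- by rewrite disjoint_sym disjoints1 in_setD1 setD11 andbF.
- by rewrite disjoint_sym disjoints1 setD11.
have [cb' ca' vc] : [/\ c != b, c != a & exchangeable v c].
  move: cM; rewrite 2!in_setD1 in_setU1 => /and3P[-> -> /orP[/eqP->|cN]].
    by split=> // w; rewrite swapii; apply: connect0.
  by split=> //; apply: exchangeable_hub.
have bc : exchangeable b c.
  exact: exchangeable_trans (exchangeable_sym vb) vc.
rewrite !inE in cb ca.
apply: connect_trans (bc z) _.
apply: connect_trans (joined_swap adj_ba _) _; first by swap_cases.
apply: connect_trans (bc _) _.
apply: connect_trans (joined_swap adj_ba _) _; first by swap_cases.
have -> : swap z b a = swap (swap (swap (swap (swap z b c) b a) b c) b a) b c.
  by apply: FS_ext => e; swap_cases.
exact: bc.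
Qed.

Lemma FS_connected : connected X -> #|X| = #|Y| -> connected (FS X Y).
Proof.
move=> [_ conX] cardXY; split; last first.
  have exch a : exchangeable v a.
    have /connectP[p] := conX v a; elim/last_ind: p a => [|p b IHp] a /=.
      by move=> _ -> z; rewrite swapii; apply: connect0.
    rewrite rcons_path last_rcons => /andP[vp pb] ->.
    by apply: exchangeable_adj pb; apply: IHp vp _.
  apply: joined_of_exchangeable => i j.
  exact: exchangeable_trans (exchangeable_sym (exch i)) (exch j).
pose f := [ffun x : X => enum_val (cast_ord cardXY (enum_rank x))].
have bij_f : bijectiveb f.
  apply/bijectivebP.
  exists (fun y => enum_val (cast_ord (esym cardXY) (enum_rank y))).
    by move=> x; rewrite ffunE enum_valK cast_ordK enum_rankK.
  by move=> y; rewrite ffunE enum_valK cast_ordKV enum_rankK.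
apply/card_gt0P; exists (exist (fun f => is_true (bijectiveb f)) f bij_f).
by [].
Qed.

End Hub.
End Mixing.

(** * Detours around an arrangement *)

Section Detours.
Variables X Y : sgraph.
Implicit Types (z w x y : FS X Y) (S : {set FS X Y}) (ls : seq X) (cs : seq Y).

Lemma connect_avoid_swap S w i j : adj i j -> adj (val w i) (val w j) ->
  w \notin S -> swap w i j \notin S -> connect (avoid S) w (swap w i j).
Proof.
move=> ij wij wS w'S; apply: connect1; apply/and3P; split=> //.
exact: FS_adj_swap.
Qed.

Definition placed z ls cs w :=
  map (val w) ls = cs /\ forall e, e \notin ls -> val w e = val z e.

Lemma placed_inj z ls cs w w' : placed z ls cs w -> placed z ls cs w' -> w = w'.
Proof.
case=> w_ls w_out [w'_ls w'_out]; apply: FS_ext => e.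
have [e_ls|e_ls] := boolP (e \in ls); last by rewrite w_out ?w'_out.
by move: w_ls; rewrite -w'_ls => /eq_in_map; apply.
Qed.

(** Rotating the leaves after each swap makes the person next in [cs] always
    the one to enter the hub, so a single step describes a whole tour. *)
Lemma placed_swap z v l ls c0 c1 cs w : uniq (v :: l :: ls) ->
    placed z (v :: l :: ls) (c0 :: c1 :: cs) w ->
  placed z (v :: rcons ls l) (c1 :: rcons cs c0) (swap w v l).
Proof.
rewrite /= inE negb_or => /andP[/andP[_ v_ls] /andP[l_ls _]].
case=> [[<- <- <-] w_out]; split=> [|e].
  rewrite /= map_rcons swapL swapR; congr (_ :: rcons _ _).
  apply/eq_in_map => e e_ls; rewrite swapD //.
    by apply: contraNneq v_ls => ->.
  by apply: contraNneq l_ls => ->.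
rewrite in_cons mem_rcons => e_out; rewrite swapD ?w_out //.
- by apply: contraNneq e_out => ->; rewrite eqxx.
- by apply: contraNneq e_out => ->; rewrite inE eqxx orbT.
Qed.

(** Detours are followed backwards from their end y, one configuration at a
    time; a configuration determines the arrangement by [placed_inj]. *)
Definition leads_to S z y ls cs :=
  forall w, placed z ls cs w -> w \notin S /\ connect (avoid S) w y.

Lemma leads_to_refl S z y ls cs :
  y \notin S -> placed z ls cs y -> leads_to S z y ls cs.
Proof. by move=> yS py w pw; rewrite (placed_inj pw py). Qed.

Lemma leads_to_step S z y v l ls c0 c1 cs : uniq (v :: l :: ls) ->
    adj v l -> adj c0 c1 ->
    (forall w, placed z (v :: l :: ls) (c0 :: c1 :: cs) w -> w \notin S) ->
    leads_to S z y (v :: rcons ls l) (c1 :: rcons cs c0) ->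
  leads_to S z y (v :: l :: ls) (c0 :: c1 :: cs).
Proof.
move=> u vl c01 free lead w pw.
have [w'S w'y] := lead _ (placed_swap u pw).
split; first exact: free.
apply: connect_trans w'y; apply: connect_avoid_swap => //; last exact: free.
by have [[-> -> _] _] := pw.
Qed.

Lemma val_neq z e e' : e != e' -> val z e <> val z e'.
Proof. by move=> ee'; apply/eqP; rewrite (inj_eq (@FS_inj _ _ z)). Qed.

(** (c i)(c j) has order 3, so alternating the two swaps six times returns to
    z; the detour is the rest of this hexagon. *)
Lemma hexagon_detour S z c i j : uniq [:: c; i; j] -> adj c i -> adj c j ->
    adj (val z c) (val z i) -> adj (val z c) (val z j) ->
    adj (val z i) (val z j) ->
    (forall w, w \in S ->
       (forall e, e \notin [:: c; i; j] -> val w e = val z e) ->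
       w = z) ->
  connect (avoid S) (swap z c i) (swap z c j).
Proof.
move=> u adj_ci adj_cj zci zcj zij free.
have [ci cj ij] : [/\ c != i, c != j & i != j].
  by move: u; rewrite /= !inE negb_or andbT => /andP[/andP[-> ->] ->].
have u' : uniq [:: c; j; i] by rewrite /= !inE negb_or cj ci eq_sym ij.
have [vci vcj vij] :
    [/\ val z c <> val z i, val z c <> val z j & val z i <> val z j].
  by split; apply: val_neq.
have avoids w : w <> z ->
    (forall e, e \notin [:: c; i; j] -> val w e = val z e) -> w \notin S.
  by move=> wz w_out; apply/negP => /free/(_ w_out).
have avoids' w : w <> z ->
    (forall e, e \notin [:: c; j; i] -> val w e = val z e) -> w \notin S.
  move=> wz w_out; apply: avoids => // e e_out; apply: w_out.
  by move: e_out; rewrite !inE !negb_or => /and3P[-> -> ->].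
have [zic zjc zji] : [/\ adj (val z i) (val z c), adj (val z j) (val z c)
    & adj (val z j) (val z i)] by split; rewrite adj_sym.
have yP : placed z [:: c; j; i] [:: val z j; val z c; val z i] (swap z c j).
  split=> [|e]; first by rewrite /= swapL swapR swapD // eq_sym.
  by rewrite !inE !negb_or => /and3P[ec ej _]; rewrite swapD // eq_sym.
have xP : placed z [:: c; j; i] [:: val z i; val z j; val z c] (swap z c i).
  split=> [|e]; first by rewrite /= swapL swapR swapD.
  by rewrite !inE !negb_or => /and3P[ec _ ei]; rewrite swapD // eq_sym.
suff lead : leads_to S z (swap z c j)
  [:: c; j; i] [:: val z i; val z j; val z c] by case: (lead _ xP).
do 4![apply: leads_to_step => //;
  [ by move=> w [[? ? ?] ?];
      first [ apply: avoids => //=; simpl in *; congruence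
            | apply: avoids' => //=; simpl in *; congruence ]
  | rewrite ![rcons _ _]/= ]].
apply: leads_to_refl (yP); apply: avoids' => [yz|]; last by case: yP.
by apply: vcj; rewrite -(swapL z c j) yz.
Qed.

(** When the people on a and b may be strangers, a common friend on a third leaf
    g separates them: (v a)(v g)(v b) has order 4, so repeating these three
    swaps gives a closed walk of length 12, in which the people on v, a, g, b
    enter the hub in this cyclic order.  The person on g leaves it with the
    second swap and is back just before the last one. *)
Lemma dodecagon_detour S z v a b g : uniq [:: v; a; b; g] ->
    adj v a -> adj v b -> adj v g ->
    adj (val z v) (val z a) -> adj (val z v) (val z b) ->
    adj (val z g) (val z a) -> adj (val z g) (val z b) ->
    swap z v a \notin S -> swap z v b \notin S ->
    (forall w, w \in S ->
       (forall e, e \notin [:: v; a; b; g] -> val w e = val z e) ->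
       val w g = val z g) ->
  connect (avoid S) (swap z v a) (swap z v b).
Proof.
move=> u va vb vg zva zvb zga zgb xS yS free.
have := u; rewrite /= !inE !negb_or !andbT.
case/and3P => /and3P[v_a v_b v_g] /andP[a_b a_g] b_g.
have [gv ga gb] :
    [/\ val z v <> val z g, val z a <> val z g & val z b <> val z g].
  by split; apply: val_neq.
have avoids ls w : perm_eq [:: v; a; b; g] ls -> val w g <> val z g ->
    (forall e, e \notin ls -> val w e = val z e) -> w \notin S.
  move=> /perm_mem eq_ls wg w_out; apply/negP => wS; apply: wg.
  by apply: free => // e; rewrite eq_ls => /w_out.
have [zav zbv zag zbg] : [/\ adj (val z a) (val z v), adj (val z b) (val z v),
    adj (val z a) (val z g) & adj (val z b) (val z g)].
  by split; rewrite adj_sym.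
have xP : placed z [:: v; g; b; a]
    [:: val z a; val z g; val z b; val z v] (swap z v a).
  split=> [|e]; first by rewrite /= swapL swapR !swapD.
  by rewrite !inE !negb_or => /and4P[ev _ _ ea]; rewrite swapD // eq_sym.
have yP : placed z [:: v; b; a; g]
    [:: val z b; val z v; val z a; val z g] (swap z v b).
  split=> [|e]; first by rewrite /= swapL swapR !swapD // eq_sym.
  by rewrite !inE !negb_or => /and4P[ev eb _ _]; rewrite swapD // eq_sym.
have perm1 : perm_eq [:: v; a; b; g] [:: v; g; b; a].
  rewrite perm_cons (perm_catC [:: a; b] [:: g]) /=.
  by rewrite perm_cons (perm_catC [:: a] [:: b]).
have perm2 : perm_eq [:: v; a; b; g] [:: v; b; a; g].
  by rewrite perm_cons (perm_catCA [:: a] [:: b] [:: g]).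
have perm3 : perm_eq [:: v; a; b; g] [:: v; a; g; b].
  by rewrite !perm_cons (perm_catC [:: b] [:: g]).
(* The swaps number 2 to 11 of the tour. *)
suff lead : leads_to S z (swap z v b)
  [:: v; g; b; a] [:: val z a; val z g; val z b; val z v] by case: (lead _ xP).
apply: leads_to_step => //; first by rewrite -(perm_uniq perm1).
  by move=> w pw; rewrite (placed_inj pw xP).
rewrite ![rcons _ _]/=.
do 9![apply: leads_to_step => //;
  [ by rewrite -?(perm_uniq perm1) -?(perm_uniq perm2) -?(perm_uniq perm3)
  | by move=> w [[? ? ? ?] ?]; first
    [ apply: (avoids _ _ perm1) => //=; simpl in *; congruence
    | apply: (avoids _ _ perm2) => //=; simpl in *; congruence
    | apply: (avoids _ _ perm3) => //=; simpl in *; congruence]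
  | rewrite ![rcons _ _]/= ]].
exact: leads_to_refl yS yP.
Qed.

Lemma square_detour S z v u a b : uniq [:: v; a; b; u] ->
    adj v u -> adj a b -> adj (val z v) (val z u) -> adj (val z a) (val z b) ->
    swap z a b \notin S ->
    (forall w, w \in S ->
       (forall e, e \notin [:: v; a; b; u] -> val w e = val z e) ->
       val w u = val z u) ->
  swap z v u \notin S /\ connect (avoid S) (swap z a b) (swap z v u).
Proof.
move=> un vu ab zvu zab xS free.
have := un; rewrite /= !inE !negb_or !andbT.
case/and3P => /and3P[v_a v_b v_u] /andP[a_b a_u] b_u.
have nvu := @val_neq z _ _ v_u.
have wS : swap z v u \notin S.
  apply: contraPN nvu => /free<- //; rewrite ?swapR // => e.
  by rewrite !inE !negb_or => /and4P[? _ _ ?]; rewrite swapD // eq_sym.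
have w'S : swap (swap z a b) v u \notin S.
  apply: contraPN nvu => /free<- //; first by swap_cases.
  by move=> e; rewrite !inE !negb_or => /and4P[? ? ? ?]; swap_cases.
split=> //; apply: (@connect_trans _ _ (swap (swap z a b) v u)).
  by apply: connect_avoid_swap => //; swap_cases.
have sq : swap (swap z a b) v u = swap (swap z v u) a b.
  by rewrite swap_comm // eq_sym.
rewrite avoid_connect_sym sq; apply: connect_avoid_swap; rewrite -?sq //.
by swap_cases.
Qed.

End Detours.

(** * Counting obstructions *)

Section Pigeonhole.
Variables X Y : sgraph.
Implicit Types (z w : FS X Y) (S : {set FS X Y}).

(** D holds the positions that every detour may disturb, L the leaves that
    label the detours.  An arrangement w of S that differs from z outside D at g
    alone obstructs only the detour labelled g, one that agrees with z outside
    D only the extra detour.  If all labels are obstructed, distinct members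
    of S other than z are in charge; if |S| = |L| + 1 they are used up
    and the extra detour is free. *)
Lemma free_leaf S z (D L : {set X}) : z \in S -> [disjoint L & D] ->
    (exists2 g, g \in L & forall w, w \in S ->
       (forall e, e \notin g |: D -> val w e = val z e) -> val w g = val z g)
  \/ #|L| < #|S| /\ (#|S| <= #|L|.+1 -> forall w, w \in S ->
       (forall e, e \notin D -> val w e = val z e) -> w = z).
Proof.
move=> zS LD; pose moved w := [set e | (e \notin D) && (val w e != val z e)].
have [/exists_inP[g gL /forall_inP free]|] :=
    boolP [exists g in L, [forall w in S, moved w != [set g]]].
  left; exists g => // w wS w_out; apply: contraNeq (free w wS) => wg.
  apply/eqP/setP=> e; rewrite !inE; have [->|eg] := eqVneq e g.
    by rewrite wg (disjointFr LD).
  have [//|eD] := boolP (e \in D); rewrite w_out ?eqxx //.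
  by rewrite in_setU1 negb_or eg.
rewrite negb_exists_in => /forall_inP blocked; right.
have moved_z : moved z = set0 by apply/setP=> e; rewrite !inE eqxx andbF.
have g_neq0 g : [set g] != set0 :> {set X} by rewrite -card_gt0 cards1.
have sub : set1 @: L \subset moved @: (S :\ z).
  apply/subsetP=> _ /imsetP[g gL ->].
  move: (blocked g gL); rewrite negb_forall_in => /exists_inP[w wS].
  rewrite negbK => /eqP wg; rewrite -wg; apply: imset_f.
  rewrite in_setD1 wS andbT.
  by apply: contraNneq (g_neq0 g) => wz; rewrite -wg wz moved_z.
have cardL : #|set1 @: L| = #|L| by apply: card_imset; apply: set1_inj.
have cardS : #|S| = #|S :\ z|.+1 by rewrite (cardsD1 z) zS.
have leS := leq_imset_card moved (mem (S :\ z)).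
have leL := subset_leq_card sub.
rewrite cardL in leL; split=> [|leSL w wS w_out].
  by rewrite cardS ltnS (leq_trans leL).
apply: contraTeq leSL => wz; rewrite -ltnNge cardS ltnS.
apply: leq_trans leS; rewrite -cardL; apply/proper_card/properP; split=> //.
exists set0.
  apply/imsetP; exists w; first by rewrite !inE wz.
  apply/esym/setP=> e; rewrite !inE.
  by case: (boolP (e \in D)) => //= /w_out->; rewrite eqxx.
by apply/imsetP=> -[g _ /esym/eqP]; apply/negP.
Qed.

End Pigeonhole.

(** * Linking the neighbours of an arrangement *)

Section Local.
Variables (X Y : sgraph) (k s : nat) (v : X).
Hypothesis few_strangers :
  forall y : Y, #|[set y' | (y' != y) && ~~ adj y y']| <= k.
Hypothesis hub : k.*2 + s <= degree v.
Implicit Types (z w x y : FS X Y) (S : {set FS X Y}).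
Let N : {set X} := [set u | adj v u].

(** The leaves other than a and b number at least 2k + s - 2, so at least s - 2
    of them hold common friends of the people on a and b.  If these two are
    strangers, each is a known stranger of the other and the count rises to s,
    more than can be obstructed; otherwise the hexagon comes to help. *)
Lemma link_hub_swaps S z a b : z \in S -> #|S| < s -> adj v a -> adj v b ->
    adj (val z v) (val z a) -> adj (val z v) (val z b) ->
    swap z v a \notin S -> swap z v b \notin S ->
  connect (avoid S) (swap z v a) (swap z v b).
Proof.
move=> zS ltSs va vb zva zvb xS yS.
have [->|ab] := eqVneq a b; first exact: connect0.
have [va' vb'] : v != a /\ v != b.
  by split; [apply: contraTneq va | apply: contraTneq vb] => <-;
    rewrite adj_irrefl.
pose A := N :\ a :\ b.
pose L := A :&: friends z a :&: friends z b.
have LP g : g \in L -> [/\ [&& g != v, g != a & g != b], adj v g,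
    adj (val z g) (val z a) & adj (val z g) (val z b)].
  rewrite !inE => /andP[/andP[/and3P[-> -> vg]]].
  rewrite ![adj _ (val z g)]adj_sym => -> ->; split=> //=; rewrite andbT.
  by apply: contraTneq vg => ->; rewrite adj_irrefl.
have LD : [disjoint L & [set v; a; b]].
  apply/pred0P=> g /=; apply/negbTE/andP=> -[/LP[/and3P[gv ga gb] _ _ _]].
  by rewrite !inE (negPf gv) (negPf ga) (negPf gb).
have cardA : #|A| + 2 = degree v.
  have [aN bN] : a \in N /\ b \in N by rewrite !inE.
  rewrite /degree -/N (cardsD1 a N) (cardsD1 b (N :\ a)) in_setD1 eq_sym ab.
  by rewrite aN bN addn2.
have aA : a \notin A by rewrite !inE eqxx andbF.
have bA : b \notin A by rewrite !inE eqxx.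
have count B C :=
  card_common_friends few_strangers (B := B) (C := C) (z := z) aA bA.
have [[g gL free]|[leL free]] := free_leaf zS LD.
  have [/and3P[gv ga gb] vg zga zgb] := LP g gL.
  apply: (@dodecagon_detour _ _ _ z v a b g) => //.
    by rewrite /= !inE !negb_or va' vb' ab ![_ == g]eq_sym gv ga gb.
  move=> w wS w_out; apply: free => // e e_out; apply: w_out.
  by move: e_out; apply: contra; rewrite !inE => /or4P[] ->; rewrite ?orbT.
have dis0 : [disjoint A & (set0 : {set X})] by rewrite -setI_eq0 setI0.
have ltL : s - 2 <= #|L|.
  have := count set0 set0 (sub0set _) (sub0set _).
  rewrite cards0 -/L => /(_ dis0 dis0) leA.
  by move: cardA hub leA; move: #|A| #|L| (degree v); clear => *; lia.
have zab : adj (val z a) (val z b).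
  apply: contraLR leL => nzab.
  have := count [set b] [set a]; rewrite -/L !sub1set !inE.
  rewrite ![_ == a]eq_sym ab nzab adj_sym nzab /=.
  rewrite ![[disjoint A & _]]disjoint_sym !disjoints1.
  rewrite aA bA !cards1 => /(_ isT isT isT isT) leA; move: cardA hub ltSs leA.
  by rewrite -leqNgt; move: #|A| #|L| #|S| (degree v); clear => *; lia.
have leSL : #|S| <= #|L|.+1.
  by move: ltSs ltL; move: #|L| #|S|; clear => *; lia.
apply: hexagon_detour => //.
  by rewrite /= !inE negb_or va' vb' ab.
move=> w wS w_out; apply: free => //.
move=> e e_out; apply: w_out; move: e_out; apply: contra.
by rewrite !inE => /or3P[] ->; rewrite ?orbT.
Qed.

(** A swap at the hub with a leaf u off the edge ab commutes with the swap of a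
    and b, whence a square.  At least k + s - 2 leaves are suitable; if they are
    all obstructed, then k = 0 and a, b are both leaves.  Then everybody is a
    friend of everybody else and the triangle a, b, v of X gives a hexagon. *)
Lemma link_to_hub_swap S z a b : z \in S -> #|S| < s -> adj a b ->
    adj (val z a) (val z b) -> swap z a b \notin S ->
  exists u, [/\ adj v u, adj (val z v) (val z u), swap z v u \notin S
    & connect (avoid S) (swap z a b) (swap z v u)].
Proof.
move=> zS ltSs ab zab xS.
have [av|av] := eqVneq a v.
  by exists b; rewrite -av; split=> //; apply: connect0.
have [bv|bv] := eqVneq b v.
  exists a; rewrite -bv swapC adj_sym [adj (val z b) _]adj_sym.
  by split=> //; apply: connect0.
have nab : a != b by apply: contraTneq ab => ->; rewrite adj_irrefl.
pose A := N :\ a :\ b; pose L := A :&: friends z v.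
have LP g : g \in L -> [/\ [&& g != v, g != a & g != b], adj v g
    & adj (val z v) (val z g)].
  rewrite !inE => /andP[/and3P[-> -> vg] ->]; split=> //=.
  by rewrite andbT; apply: contraTneq vg => ->; rewrite adj_irrefl.
have LD : [disjoint L & [set v; a; b]].
  apply/pred0P=> g /=; apply/negbTE/andP=> -[/LP[/and3P[gv ga gb] _ _]].
  by rewrite !inE (negPf gv) (negPf ga) (negPf gb).
have [[g gL free]|[leL free]] := free_leaf zS LD.
  have [/and3P[gv ga gb] vg zvg] := LP g gL.
  exists g; have [||||||//|] := @square_detour _ _ S z v g a b.
  - rewrite /= !inE !negb_or ![v == _]eq_sym av bv nab gv.
    by rewrite ![_ == g]eq_sym ga gb.
  - by [].
  - by [].
  - by [].
  - by [].
  - by [].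
  - move=> w wS w_out; apply: free => // e e_out; apply: w_out.
    by move: e_out; apply: contra; rewrite !inE => /or4P[] ->; rewrite ?orbT.
  by split.
have cardA : degree v = (a \in N) + (b \in N) + #|A|.
  rewrite /degree -/N (cardsD1 a N) (cardsD1 b (N :\ a)).
  by rewrite in_setD1 eq_sym nab addnA.
have vA : v \notin A by rewrite !inE adj_irrefl !andbF.
have dis0 : [disjoint A & (set0 : {set X})] by rewrite -setI_eq0 setI0.
have := card_friends few_strangers (z := z) vA (sub0set _) dis0.
rewrite cards0 addn0 -/L => leA.
have [k0 [aN bN]] : k = 0 /\ a \in N /\ b \in N.
  move: cardA leA leL hub ltSs; case: (a \in N); case: (b \in N);
    by clearbody L A; clear => /= *; lia.
have friendly c d : c != d -> adj (val z c) (val z d).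
  move=> cd; have := few_strangers (val z c); rewrite k0 leqn0 cards_eq0.
  apply: contraLR => nzcd; apply/set0Pn; exists (val z d).
  by rewrite inE nzcd andbT (inj_eq (@FS_inj _ _ z)) eq_sym.
have va : adj v a by rewrite inE in aN.
have leSL : #|S| <= #|L|.+1.
  move: cardA leA hub ltSs; rewrite aN bN.
  by move: #|A| #|L| #|S| (degree v); clear => *; lia.
have freeS := free leSL.
have zva : adj (val z v) (val z a) by apply: friendly; rewrite eq_sym.
exists a; split=> //.
- apply: contraTN zva => /freeS/(_ _) wz.
  rewrite -(swapL z v a) wz ?adj_irrefl // => e.
  by rewrite !inE !negb_or => /andP[/andP[ev ea] _]; rewrite swapD // eq_sym.
- rewrite [swap z v a]swapC; apply: hexagon_detour => //.
  + by rewrite /= !inE negb_or nab av bv.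
  + by rewrite adj_sym.
  + exact: friendly.
  + exact: friendly.
  move=> w wS w_out; apply: freeS => // e e_out; apply: w_out.
  by move: e_out; apply: contra; rewrite !inE => /or3P[] ->; rewrite ?orbT.
Qed.

Lemma FS_locally_linked : locally_linked (FS X Y) s.
Proof.
move=> S z x y ltSs zS xS yS.
move=> /FS_adjP[a [b [ab zab dx]]] /FS_adjP[c [d [cd zcd dy]]].
rewrite dx in xS *; rewrite dy in yS *.
have [u [vu zu uS xu]] := link_to_hub_swap zS ltSs ab zab xS.
have [u' [vu' zu' u'S yu']] := link_to_hub_swap zS ltSs cd zcd yS.
apply: connect_trans xu _; apply: (@connect_trans _ _ (swap z v u')).
  exact: link_hub_swaps.
by rewrite avoid_connect_sym.
Qed.

(** In terms of the hub alone; the s + 1 arrangements needed for the order of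
    FS(X, Y) are some z and its swaps at the hub. *)
Theorem FS_s_connected : 2 <= s -> connected X -> #|X| = #|Y| ->
  s_connected s (FS X Y).
Proof.
move=> s2 conX cardXY.
have hub2 : k.*2 + 2 <= degree v by apply: leq_trans hub; rewrite leq_add2l.
have conFS := FS_connected few_strangers hub2 conX cardXY.
apply: s_connected_of_local => //; last exact: FS_locally_linked.
  exact: ltnW.
have /card_gt0P[z _] := conFS.1.
have inj : {in v |: N &, injective (swap z v)}.
  move=> a b _ _ eq_ab; apply: (@FS_inj _ _ z).
  by rewrite -(swapL z v a) eq_ab swapL.
apply: leq_trans (max_card (mem (swap z v @: (v |: N)))).
rewrite card_in_imset // cardsU1 inE adj_irrefl add1n ltnS.
exact: leq_trans (leq_addl _ _) hub.
Qed.

End Local.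

(** * From degrees to the hub *)

Lemma min_degree_le (G : sgraph) (x : G) : min_degree G <= degree x.
Proof.
rewrite /min_degree; have := mem_index_enum x.
elim: (index_enum G) => // y r IHr; rewrite inE big_cons geq_min.
by case/orP=> [/eqP->|/IHr->]; rewrite ?leqnn ?orbT.
Qed.

Lemma neighbors_sub (G : sgraph) (x : G) : [set y | adj x y] \subset ~: [set x].
Proof.
by apply/subsetP=> y; rewrite !inE; apply: contraTneq => ->; rewrite adj_irrefl.
Qed.

Lemma min_degree_le_predn (G : sgraph) : 0 < #|G| -> min_degree G <= #|G|.-1.
Proof.
case/card_gt0P=> x _; apply: leq_trans (min_degree_le x) _.
by rewrite -(cardsC1 x); apply/subset_leq_card/neighbors_sub.
Qed.

Lemma card_non_neighbors (G : sgraph) (x : G) :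
  #|[set y | (y != x) && ~~ adj x y]| <= #|G|.-1 - min_degree G.
Proof.
have -> : [set y | (y != x) && ~~ adj x y] = ~: [set x] :\: [set y | adj x y].
  by apply/setP=> y; rewrite !inE andbC.
rewrite cardsDS ?neighbors_sub // cardsC1.
exact/leq_sub2l/min_degree_le.
Qed.

Theorem theorem1p9 (s n : nat) (X Y : sgraph)
  (hs : 2 <= s) (hn : 6 <= n) (hX : #|X| = n) (hY : #|Y| = n)
  (cX : connected X) (cY : connected Y)
  (hdelta : min_degree X <= min_degree Y)
  (hDelta : ((4 / 3) * (min_degree X)%:R <= (max_degree X)%:R :> rat)%R)
  (hsum : (3 * n%:R + 3 * s%:R / 2 - 3
            <= 2 * (min_degree X)%:R + 3 * (min_degree Y)%:R :> rat)%R) :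
  s_connected s (FS X Y).
Proof.
have [v degv] : {v : X | max_degree X = degree v}.
  by apply: eq_bigmax; rewrite hX; apply: leq_trans hn.
have min_max : 4 * min_degree X <= 3 * max_degree X.
  by rewrite -(ler_nat rat) !natrM; lra.
have sum_nat : 6 * n + 3 * s <= 4 * min_degree X + 6 * min_degree Y + 6.
  rewrite -(ler_nat rat) natrD 2![in X in (_ <= X)%R]natrD !natrM; lra.
apply: (@FS_s_connected X Y (n.-1 - min_degree Y) s v) => //.
- by move=> y; rewrite -hY; apply: card_non_neighbors.
- have : min_degree Y <= n.-1.
    by rewrite -hY min_degree_le_predn // hY (leq_trans _ hn).
  rewrite -degv.
  move: (max_degree X) (min_degree X) (min_degree Y) min_max sum_nat hn.
  by clear => *; lia.
- by rewrite hX hY.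
Qed.
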